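(* For all integers $m \geq 1$ and $n \geq 1$, with $t = t(m,n) = 2^{6n^3m^2}$ and $u = u(t(m,n)) = 6t^3+5$, $$\left\lfloor \sqrt[m]{n} \right\rfloor = \left( \frac{\operatorname{HW}(M(h'', m, n, t, u))}{u} - t^9 \right) - 1,$$ where $$h''(m,n,x,y,z,w,g,s,r,q,d) = (2^{3mx} - z)^2 + (2^{3mx} q - g)^2 + (w - xq)^2 + (2^{3m^2x} - s)^2 + (2^n - 2^{r+y})^2 + (2^{2t} - 2^{2t}\cdot 2^{z+r-s-w})^2 + (2^{t} - 2\cdot 2^{t}\cdot 2^{x+r+d-z})^2 .$$
   Context: $\operatorname{HW}(N)$ is the Hamming weight of $N$, i.e. the number of $1$s in the binary representation of $N$. For integers $a,b$ with $0 \leq a < 2^b$, put $\delta(a,b) = (2^b-1)(2^b - a + 1)$. For $\vec a = (a_1,\dots,a_9) \in \{0,\dots,t-1\}^9$ put $\beta(\vec a) = a_1 + a_2 t + \cdots + a_9 t^8$, and define $$M(h'',m,n,t,u) = \sum_{\vec a \in \{0,\dots,t-1\}^9} 2^{2u\beta(\vec a)}\, \delta(h''(m,n,\vec a), u),$$ where $(a_1,\dots,a_9)$ is substituted for $(x,y,z,w,g,s,r,q,d)$ in this order. ($h''$ takes integer values in $[0, 2^u)$ on this cube.) $\lfloor \sqrt[m]{n} \rfloor$ is the largest natural number $k$ with $k^m \leq n$.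
   Formalization: In the sixth square of h'' the exponent z+r-s-w is replaced by g+r-s-w. As printed the formula fails for all m,n ≥ 1: x=w=r=d=0, z=s=1, y=n, g=q is a zero of h'' for each of the t values of q, so the right side is at least t-1 > n. *)

(* Defs.v *)
From mathcomp Require Import all_boot all_order all_algebra.
From mathcomp Require Import zify ring lra.

Set Implicit Arguments.
Unset Strict Implicit.
Unset Printing Implicit Defensive.

Import Order.TTheory GRing.Theory Num.Theory.

Local Open Scope ring_scope.

(* The bits of index i >= N all vanish, since N < 2 ^ N. *)
Definition HW (N : nat) : nat := (\sum_(i < N) odd (N %/ 2 ^ i))%N.

(* The search bound k <= n loses nothing when 0 < m; see floor_rootP. *)
Definition floor_root (m n : nat) : nat :=
  (\max_(k < n.+1 | k ^ m <= n) k)%N.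

Definition t_of (m n : nat) : nat := (2 ^ (6 * n ^ 3 * m ^ 2))%N.

Definition u_of (t : nat) : nat := (6 * t ^ 3 + 5)%N.

(* h'' has integer values on the cube, but its subterms 2 ^ (g + r - s - w) and
   2 ^ (x + r + d - z) have possibly negative exponents, so everything is
   computed in rat; hpp_int and hpp_itv below recover the integrality and the
   range. *)
Definition delta (a : rat) (b : nat) : rat :=
  (2 ^+ b - 1) * (2 ^+ b - a + 1).

Definition beta (t : nat) (a : {ffun 'I_9 -> 'I_t}) : nat :=
  (\sum_(i < 9) a i * t ^ i)%N.

Definition M
    (h : nat -> nat ->
         nat -> nat -> nat -> nat -> nat -> nat -> nat -> nat -> nat -> rat)
    (m n t u : nat) : rat :=
  \sum_(a : {ffun 'I_9 -> 'I_t})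
     let v (k : nat) : nat := a (inord k) in
     2 ^+ (2 * u * beta a) *
     delta (h m n (v 0%N) (v 1%N) (v 2%N) (v 3%N) (v 4%N)
                  (v 5%N) (v 6%N) (v 7%N) (v 8%N)) u.

(* The sixth square encodes g + r = s + w, i.e. z ^ m = q (z - x) + r once
   z = 2 ^ (3 m x), g = z q, w = x q and s = z ^ m.  The source prints the
   exponent as z + r - s - w.  That is a misprint: q would then be
   unconstrained when x = 0 (take z = s = 1, w = r = d = 0, y = n, g = q), so
   h'' would have at least t zeros on the cube instead of
   floor_root m n + 1 < t, and the formula for the root would fail for all
   m, n >= 1. *)
Definition hpp (m n x y z w g s r q d : nat) : rat :=
  let t := t_of m n in
    (2 ^+ (3 * m * x) - z%:R) ^+ 2
  + (2 ^+ (3 * m * x) * q%:R - g%:R) ^+ 2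
  + (w%:R - x%:R * q%:R) ^+ 2
  + (2 ^+ (3 * m ^ 2 * x) - s%:R) ^+ 2
  + (2 ^+ n - 2 ^+ (r + y)) ^+ 2
  + (2 ^+ (2 * t)
     - 2 ^+ (2 * t) * 2 ^ (g%:Z + r%:Z - s%:Z - w%:Z)) ^+ 2
  + (2 ^+ t - 2 * 2 ^+ t * 2 ^ (x%:Z + r%:Z + d%:Z - z%:Z)) ^+ 2.

Lemma floor_rootP (m n : nat) : (0 < m)%N ->
  (floor_root m n ^ m <= n)%N /\
  (forall k : nat, (k ^ m <= n)%N -> (k <= floor_root m n)%N).
Proof.
move=> m0; split.
  rewrite /floor_root; apply: (big_ind (fun k => k ^ m <= n)%N).
  - by rewrite exp0n.
  - by move=> a b ha hb; rewrite /maxn; case: ifP.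
  - by [].
move=> k hk; have lekn : (k < n.+1)%N.
  rewrite ltnS; apply: leq_trans hk.
  by case: k => [|k] //; rewrite -{1}(expn1 k.+1) leq_pexp2l.
exact: (@leq_bigmax_cond _ (fun i : 'I_n.+1 => i ^ m <= n)%N
          (fun i => i : nat) (Ordinal lekn)).
Qed.

Lemma exp2_shift (a : nat) (e : int) : 0 <= a%:Z + e ->
  (2 : rat) ^+ a * 2 ^ e = 2 ^+ absz (a%:Z + e).
Proof.
move=> h; rewrite (exprnP _ a) -expfzDr //.
by rewrite -[in LHS](gez0_abs h) -exprnP.
Qed.

Section Range.
Variables m n x y z w g s r q d : nat.
Let t := t_of m n.
Hypotheses (hm : (1 <= m)%N) (hn : (1 <= n)%N).
Hypotheses (hx : (x < t)%N) (hy : (y < t)%N) (hz : (z < t)%N) (hw : (w < t)%N)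
  (hg : (g < t)%N) (hs : (s < t)%N) (hr : (r < t)%N) (hq : (q < t)%N)
  (hd : (d < t)%N).

Let N6 : nat := (2 ^ absz ((2 * t)%N%:Z + (g%:Z + r%:Z - s%:Z - w%:Z))%R)%N.
Let N7 : nat := (2 ^ absz ((t.+1)%:Z + (x%:Z + r%:Z + d%:Z - z%:Z))%R)%N.

Let hppE : hpp m n x y z w g s r q d =
    ((2 ^ (3 * m * x))%N%:R - z%:R) ^+ 2
  + ((2 ^ (3 * m * x) * q)%N%:R - g%:R) ^+ 2
  + (w%:R - (x * q)%N%:R) ^+ 2
  + ((2 ^ (3 * m ^ 2 * x))%N%:R - s%:R) ^+ 2
  + ((2 ^ n)%N%:R - (2 ^ (r + y))%N%:R) ^+ 2
  + ((2 ^ (2 * t))%N%:R - N6%:R) ^+ 2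
  + ((2 ^ t)%N%:R - N7%:R) ^+ 2.
Proof.
rewrite /hpp /N6 /N7 -/t !natrM !natrX -exprS !exp2_shift //; lia.
Qed.

Lemma hpp_int : hpp m n x y z w g s r q d \is a Num.int.
Proof.
have sq (a b : nat) : ((a%:R - b%:R) ^+ 2 : rat) \is a Num.int.
  by apply: rpredX; apply: rpredB; apply: natr_int.
by rewrite hppE; do 6![apply: rpredD; last exact: sq]; exact: sq.
Qed.

Let sqr_le (a b K : nat) : (a <= 2 ^ K)%N -> (b <= 2 ^ K)%N ->
  ((a%:R - b%:R : rat) ^+ 2 <= 2 ^+ (2 * K)).
Proof.
move=> ha hb; rewrite mulnC exprM.
have {}ha : a%:R <= (2 : rat) ^+ K by rewrite -natrX ler_nat.
have {}hb : b%:R <= (2 : rat) ^+ K by rewrite -natrX ler_nat.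
have a0 : 0 <= a%:R :> rat by []; have b0 : 0 <= b%:R :> rat by [].
rewrite -[leLHS]real_normK ?num_real //.
by rewrite lerXn2r ?nnegrE ?exprn_ge0 // ler_norml; lra.
Qed.

Lemma hpp_itv : 0 <= hpp m n x y z w g s r q d < 2 ^+ u_of t.
Proof.
apply/andP; split; first by rewrite /hpp !addr_ge0 // sqr_ge0.
have [ht hnt] : (6 * m ^ 2 <= t /\ n <= t)%N.
  have lt_et : (6 * n ^ 3 * m ^ 2 < t)%N by rewrite /t /t_of ltn_expl.
  have n3 : (n <= n ^ 3)%N by rewrite -{1}(expn1 n) leq_pexp2l.
  have m2 : (1 <= m ^ 2)%N by rewrite expn_gt0 hm.
  by split; nia.
have mt : (m <= m ^ 2)%N by rewrite -{1}(expn1 m) leq_pexp2l.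
have t6 : (6 <= t)%N by nia.
have t2t : (t <= 2 ^ t)%N by apply: ltnW; rewrite ltn_expl.
pose K := (t * t + 4 * t + 1)%N.
have leK e : (e <= K)%N -> (2 ^ e <= 2 ^ K)%N by move=> ?; rewrite leq_pexp2l.
have lev v : (v < t)%N -> (v <= 2 ^ K)%N.
  move=> hv; apply: leq_trans (ltnW hv) _; apply: leq_trans t2t _.
  by apply: leK; rewrite /K; nia.
have lev2 v e : (e + t <= K)%N -> (v < t)%N -> (2 ^ e * v <= 2 ^ K)%N.
  move=> he hv; apply: (leq_trans _ (leK _ he)).
  by rewrite expnD leq_mul2l orbC (leq_trans (ltnW hv) t2t).
have b1 : ((2 ^ (3 * m * x))%N%:R - z%:R : rat) ^+ 2 <= 2 ^+ (2 * K).
  by apply: sqr_le; [apply: leK; rewrite /K; nia | exact: lev].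
have b2 : ((2 ^ (3 * m * x) * q)%N%:R - g%:R : rat) ^+ 2 <= 2 ^+ (2 * K).
  by apply: sqr_le; [apply: lev2 => //; rewrite /K; nia | exact: lev].
have b3 : (w%:R - (x * q)%N%:R : rat) ^+ 2 <= 2 ^+ (2 * K).
  apply: sqr_le; [exact: lev | apply: leq_trans (lev2 q t _ hq)].
    by rewrite leq_mul2r (leq_trans (ltnW hx) t2t) orbT.
  by rewrite /K; nia.
have b4 : ((2 ^ (3 * m ^ 2 * x))%N%:R - s%:R : rat) ^+ 2 <= 2 ^+ (2 * K).
  by apply: sqr_le; [apply: leK; rewrite /K; nia | exact: lev].
have b5 : ((2 ^ n)%N%:R - (2 ^ (r + y))%N%:R : rat) ^+ 2 <= 2 ^+ (2 * K).
  by apply: sqr_le; apply: leK; rewrite /K; nia.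
have b6 : ((2 ^ (2 * t))%N%:R - N6%:R : rat) ^+ 2 <= 2 ^+ (2 * K).
  by apply: sqr_le; apply: leK; rewrite /K; lia.
have b7 : ((2 ^ t)%N%:R - N7%:R : rat) ^+ 2 <= 2 ^+ (2 * K).
  by apply: sqr_le; apply: leK; rewrite /K; lia.
have hu : (2 * K + 3 <= u_of t)%N.
  by rewrite /u_of /K !expnS expn0; nia.
have {}hu : 8 * 2 ^+ (2 * K) <= 2 ^+ u_of t :> rat.
  apply: le_trans (ler_weXn2l _ hu); last by [].
  by rewrite exprD mulrC.
have p0 : 0 < 2 ^+ (2 * K) :> rat by rewrite exprn_gt0.
by rewrite hppE; lra.
Qed.

End Range.

Lemma M_nat (m n : nat) : (1 <= m)%N -> (1 <= n)%N ->
  M hpp m n (t_of m n) (u_of (t_of m n)) \is a Num.nat.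
Proof.
move=> hm hn; apply: rpred_sum => a _ /=; apply: rpredM.
  by rewrite rpredX // natr_nat.
rewrite natrEint; set u := u_of _; set h := hpp _ _ _ _ _ _ _ _ _ _ _.
have hi : h \is a Num.int by exact: hpp_int.
have /andP[h0 hlt] : 0 <= h < 2 ^+ u by exact: hpp_itv.
have i2 : (2 : rat) ^+ u \is a Num.int by rewrite -natrX natr_int.
apply/andP; split.
  by rewrite rpredM ?rpredD ?rpredB ?rpredN ?rpred1.
rewrite mulr_ge0 // ?subr_ge0 ?exprn_ege1 //; lra.
Qed.

(* Main.v *)
(** For 0 <= h < 2^u the number (2^u - 1)(2^u - h + 1) has at most 2u bits; its
    Hamming weight is u if h > 0, and 2u if h = 0, where it equals 2^(2u) - 1.
    The blocks in M do not overlap, so HW(M)/u is t^9 plus the number of zeros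
    of h'' on the cube.  At a zero z = 2^(3mx), and z^m = q(z - x) + r with
    r < z - x is a Euclidean division.  As z = x mod (z - x) and
    x^m < z - x, the remainder r is x^m, and r + y = n says that x^m <= n.  All
    other variables are determined by x, so there is one zero for each
    x <= floor(n^(1/m)). *)

Require Import Defs.
From mathcomp Require Import all_boot all_order all_algebra.
From mathcomp Require Import zify ring.

Import Order.TTheory GRing.Theory Num.Theory.

(** * Hamming weights of concatenated and complemented bit blocks *)

Lemma sum_bits_widen (N k l : nat) : N < 2 ^ k -> k <= l ->
  \sum_(i < l) odd (N %/ 2 ^ i) = \sum_(i < k) odd (N %/ 2 ^ i).
Proof.
move=> hN; elim: l => [|l IH]; first by rewrite leqn0 => /eqP ->.
rewrite leq_eqVlt => /orP[/eqP <- // | hkl].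
rewrite big_ord_recr /= IH // divn_small ?addn0 //.
by apply: leq_trans hN _; rewrite leq_pexp2l.
Qed.

Lemma HW_sum_bits (N k : nat) : N < 2 ^ k ->
  HW N = \sum_(i < k) odd (N %/ 2 ^ i).
Proof.
move=> hN; case: (leqP N k) => hk.
  by rewrite (sum_bits_widen N N k) // ltn_expl.
by rewrite /HW (sum_bits_widen N k N) // ltnW.
Qed.

Lemma HW_add_shift (k A B : nat) : A < 2 ^ k -> HW (A + 2 ^ k * B) = HW A + HW B.
Proof.
move=> hA; have hB : B < 2 ^ B by rewrite ltn_expl.
(* The width [k + B] leaves [B] bits above the first [k], exactly as many as the definition of
   [HW B] sums. *)
rewrite (@HW_sum_bits _ (k + B)); last by rewrite expnD; nia.
rewrite big_split_ord /= (HW_sum_bits A k) // [HW B]/HW; congr addn.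
  apply: eq_bigr => i _; have hi := ltn_ord i.
  (* Below position [k] the term [2 ^ k * B] adds an even number to the quotient, so the parity is
     that of [A]. *)
  have -> : 2 ^ k = 2 ^ i * 2 ^ (k - i) by rewrite -expnD subnKC // ltnW.
  rewrite -mulnA [2 ^ i * _]mulnC addnC divnMDl ?expn_gt0 // oddD oddM oddX.
  by rewrite orbF subn_eq0 leqNgt hi.
apply: eq_bigr => i _.
by rewrite expnD divnMA addnC mulnC divnMDl ?expn_gt0 // [A %/ _]divn_small ?addn0.
Qed.

(** Subtraction from the all-ones number [2 ^ k - 1] flips every bit; the induction peels off the
    lowest one. *)
Lemma HW_complement (k b : nat) : b < 2 ^ k -> HW (2 ^ k - 1 - b) + HW b = k.
Proof.
elim: k b => [|k IH] b hb.
  by have -> : b = 0 by [lia]; rewrite /HW /= !big_ord0.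
have hb2 : b = b %% 2 + 2 ^ 1 * (b %/ 2) by lia.
have lt2 : b %/ 2 < 2 ^ k by move: hb; rewrite expnS; lia.
have -> : 2 ^ k.+1 - 1 - b = (1 - b %% 2) + 2 ^ 1 * (2 ^ k - 1 - b %/ 2).
  by rewrite expnS; lia.
rewrite [in HW b]hb2 !HW_add_shift; try lia.
rewrite addnACA IH //.
have : b %% 2 < 2 by rewrite ltn_mod.
by case: (b %% 2) => [|[|//]] _; rewrite /HW !big_ord_recr !big_ord0.
Qed.

Lemma HW_pred_expn_mul (k B : nat) : 0 < B <= 2 ^ k -> HW ((2 ^ k - 1) * B) = k.
Proof.
case: B => // b /andP[_ hb].
(* The low half is the complement of the high half. *)
have -> : (2 ^ k - 1) * b.+1 = (2 ^ k - 1 - b) + 2 ^ k * b by nia.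
by rewrite HW_add_shift ?HW_complement //; lia.
Qed.

Lemma HW_digits (k l : nat) (F : 'I_l -> nat) : (forall i, F i < 2 ^ k) ->
  HW (\sum_(i < l) 2 ^ (k * i) * F i) = \sum_(i < l) HW (F i).
Proof.
elim: l F => [|l IH] F hF; first by rewrite !big_ord0 /HW big_ord0.
rewrite !big_ord_recl muln0 mul1n -IH //.
under eq_bigr => i _ do rewrite lift0 mulnS expnD -mulnA.
by rewrite -big_distrr HW_add_shift.
Qed.

(** * Base-[t] digits and the enumeration of the cube *)

Lemma digits_lt (t k : nat) (f : 'I_k -> nat) : (forall i, f i < t) ->
  \sum_(i < k) f i * t ^ i < t ^ k.
Proof.
elim: k f => [|k IH] f hf; first by rewrite big_ord0.
rewrite big_ord_recr /= expnS.
have := IH (fun i => f (widen_ord (leqnSn k) i)) (fun i => hf _).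
set S := \sum_(i < k) _ => hS.
apply: (@leq_trans ((f ord_max).+1 * t ^ k)); last by rewrite leq_mul2r hf orbT.
by rewrite mulSn ltn_add2r.
Qed.

Lemma digits_inj (t k : nat) (f g : 'I_k -> nat) :
  (forall i, f i < t) -> (forall i, g i < t) ->
  \sum_(i < k) f i * t ^ i = \sum_(i < k) g i * t ^ i -> f =1 g.
Proof.
elim: k f g => [|k IH] f g hf hg; first by move=> _ [].
have E h : \sum_(i < k.+1) h i * t ^ i
    = (\sum_(i < k) h (lift ord0 i) * t ^ i) * t + h ord0.
  rewrite big_ord_recl muln1 addnC big_distrl /=; congr addn.
  by apply: eq_bigr => i _; rewrite expnSr mulnA.
rewrite !E => e.
have e0 : f ord0 = g ord0.
  by have := congr1 (modn^~ t) e; rewrite !modnMDl !modn_small.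
have t0 : 0 < t by apply: leq_ltn_trans (hf ord0).
have /IH e1 : \sum_(i < k) f (lift ord0 i) * t ^ i
    = \sum_(i < k) g (lift ord0 i) * t ^ i.
  by move: e; rewrite e0 => /addIn /eqP; rewrite eqn_pmul2r // => /eqP.
by move=> i; case: (unliftP ord0 i) => [j|] ->; [exact: e1|].
Qed.

(** [beta] is injective into a range of the same size [t ^ 9] as the cube, hence a bijection: each
    block position is filled exactly once. *)
Lemma HW_sum_beta (t k : nat) (F : {ffun 'I_9 -> 'I_t} -> nat) :
  (forall a, F a < 2 ^ k) ->
  HW (\sum_a 2 ^ (k * beta a) * F a) = \sum_a HW (F a).
Proof.
move=> hF.
have ltb (a : {ffun 'I_9 -> 'I_t}) : beta a < t ^ 9.
  exact: (digits_lt t 9 (fun i => a i)).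
pose b a := Ordinal (ltb a).
have binj : injective b.
  move=> a a' /(congr1 val) /= e; apply/ffunP => i; apply: val_inj.
  exact: (digits_inj t 9 (fun i => a i) (fun i => a' i)).
have [c bK cK] : bijective b by apply: inj_card_bij; rewrite // card_ffun !card_ord.
have bon P : {on P, bijective b} by apply: onW_bij; exists c.
have -> : \sum_a 2 ^ (k * beta a) * F a = \sum_(i < t ^ 9) 2 ^ (k * i) * F (c i).
  by rewrite (reindex b) //=; apply: eq_bigr => a _; rewrite bK.
rewrite HW_digits // (reindex b) //=.
by apply: eq_bigr => a _; rewrite bK.
Qed.

(** * The Hamming weight of a sum of shifted [delta] blocks *)

Lemma truncn_sum_delta (t u : nat) (h : {ffun 'I_9 -> 'I_t} -> rat)
    (h0 : {ffun 'I_9 -> 'I_t} -> nat) :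
  (forall a, h a = (h0 a)%:R%R) -> (forall a, h0 a < 2 ^ u) ->
  Num.truncn (\sum_a 2 ^+ (2 * u * beta a) * delta (h a) u)%R
  = \sum_a 2 ^ (2 * u * beta a) * ((2 ^ u - 1) * (2 ^ u - h0 a + 1)).
Proof.
move=> hE hlt; rewrite -[RHS](@natrK rat); congr Num.truncn.
rewrite natr_sum; apply: eq_bigr => a _.
(* [h0 a < 2 ^ u] keeps the subtraction in [nat] from truncating. *)
rewrite /delta hE !natrM natrD !natrB ?expn_gt0 //; last exact: ltnW.
by rewrite !natrX.
Qed.

Lemma HW_sum_delta (t u : nat) (h : {ffun 'I_9 -> 'I_t} -> rat) :
  (forall a, h a \is a Num.int) -> (forall a, 0 <= h a < 2 ^+ u)%R ->
  HW (Num.truncn (\sum_a 2 ^+ (2 * u * beta a) * delta (h a) u)%R)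
  = u * (t ^ 9 + #|[set a | h a == 0%R]|).
Proof.
move=> hint hitv; pose h0 a := Num.truncn (h a).
have hE a : h a = (h0 a)%:R%R.
  by have /andP[h_ge0 _] := hitv a; rewrite truncnK // natrEint hint.
have hlt a : h0 a < 2 ^ u.
  by have /andP[_] := hitv a; rewrite hE -natrX ltr_nat.
rewrite (truncn_sum_delta t u h h0 hE hlt) HW_sum_beta; last first.
  (* Each block fits in [2 * u] bits, as [(2 ^ u - 1) * (2 ^ u + 1) = 2 ^ (2 * u) - 1]. *)
  move=> a; rewrite mul2n -addnn expnD.
  by have : 0 < 2 ^ u; [rewrite expn_gt0 | nia].
transitivity (\sum_(a : {ffun 'I_9 -> 'I_t}) (u + u * (h a == 0%R))).
  apply: eq_bigr => a _; rewrite hE pnatr_eq0; case: eqP => [-> | /eqP h_neq0].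
    have -> : (2 ^ u - 1) * (2 ^ u - 0 + 1) = 2 ^ (u + u) - 1 - 0.
      by rewrite expnD; have : 0 < 2 ^ u; [rewrite expn_gt0 | nia].
    have := HW_complement (u + u) 0; rewrite expn_gt0 => /(_ isT).
    by rewrite {2}/HW big_ord0; lia.
  by rewrite HW_pred_expn_mul ?muln0 ?addn0 //; have := hlt a; lia.
rewrite big_split /= sum_nat_const card_ffun !card_ord -big_distrr /=.
by rewrite mulnDr [u * t ^ 9]mulnC -sum1dep_card [in RHS]big_mkcond.
Qed.

(** * The zeros of h'' and their number *)

(** Makes [x ^ m] smaller than the divisor [z - x], where [z = 2 ^ (3 * m * x)]. For [x > 0] both
    summands are at most [2 ^ (m * x)], the first strictly less, and [m * x + 1 <= 3 * m * x]. *)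
Lemma expn_add_lt (m x : nat) : 0 < m -> x ^ m + x < 2 ^ (3 * m * x).
Proof.
move=> m0; case: (posnP x) => [->|x0]; first by rewrite exp0n // muln0.
have h1 : x ^ m < 2 ^ (m * x) by rewrite mulnC expnM ltn_exp2r // ltn_expl.
have h2 : x <= 2 ^ (m * x).
  by apply: leq_trans (ltnW (ltn_expl x (ltnSn 1))) _;
     rewrite leq_pexp2l // leq_pmull.
have : 2 ^ (m * x).+1 <= 2 ^ (3 * m * x) by rewrite leq_pexp2l //; nia.
by rewrite expnS; lia.
Qed.

Section Zeros.
Local Open Scope ring_scope.

(** A sum of squares vanishes only termwise, and [2 ^ e = 1] forces [e = 0] for negative exponents
    too. In the result [y] and [d] are slack variables for [r <= n] and [r < z - x]. *)
Lemma hpp_eq0 (m n x y z w g s r q d : nat) :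
  hpp m n x y z w g s r q d = 0 <->
  [/\ z = (2 ^ (3 * m * x))%N, s = (2 ^ (3 * m ^ 2 * x))%N &
   [/\ w = (x * q)%N, g = (z * q)%N, (r + y)%N = n,
       (g + r = s + w)%N & (x + r + d + 1)%N = z]].
Proof.
have eqX (e : int) : ((2 : rat) ^ e == 1) = (e == 0).
  by rewrite -[1](expr0z (2 : rat)); apply: (inj_eq (@ieexprIz _ _ _ _)).
have hE : (hpp m n x y z w g s r q d == 0) =
  [&& (2 ^ (3 * m * x) == z)%N, (2 ^ (3 * m * x) * q == g)%N,
      (w == x * q)%N, (2 ^ (3 * m ^ 2 * x) == s)%N, (n == r + y)%N,
      g%:Z + r%:Z - s%:Z - w%:Z == 0
    & x%:Z + r%:Z + d%:Z - z%:Z == -1].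
  have e6 (N : nat) (e : int) : ((2 : rat) ^+ N - 2 ^+ N * 2 ^ e == 0) = (e == 0).
    rewrite subr_eq0 -{1}[2 ^+ N]mulr1 (inj_eq (mulfI _)) ?expf_neq0 //.
    by rewrite eq_sym eqX.
  (* The extra factor 2 shifts the exponent by one, which makes [r < z - x] strict. *)
  have e7 (N : nat) (e : int) :
      ((2 : rat) ^+ N - 2 * 2 ^+ N * 2 ^ e == 0) = (e == -1).
    by rewrite -addr_eq0 -(e6 N) expfzDr // expr1z; congr (_ == _); ring.
  rewrite /hpp; move: (_ - w%:Z) (_ - z%:Z) => a b.
  rewrite !paddr_eq0 ?addr_ge0 ?sqr_ge0 // !sqrf_eq0 e6 e7 !subr_eq0.
  by rewrite -!natrX -!natrM !eqr_nat eqn_exp2l // -!andbA.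
split.
  move=> /eqP; rewrite hE => /and5P[/eqP <- /eqP <- /eqP -> /eqP <-].
  move=> /and3P[/eqP -> /eqP h6 /eqP h7].
  by split=> //; split=> //; lia.
move=> [ez es [ew eg ey h6 h7]]; apply/eqP; rewrite hE.
by rewrite ew eg -ey -es -ez !eqxx /=; apply/andP; split; apply/eqP; lia.
Qed.
End Zeros.

(* In the order x, y, z, w, g, s, r, q, d; a zero of h'' only if x ^ m <= n,
   as n - x ^ m is truncated. *)
Definition hpp_zero (m n x : nat) : seq nat :=
  let z0 := 2 ^ (3 * m * x) in let q0 := z0 ^ m %/ (z0 - x) in
  [:: x; n - x ^ m; z0; x * q0; z0 * q0; z0 ^ m; x ^ m; q0; z0 - x - x ^ m - 1].

Lemma hpp_zero_unique (m n x y z w g s r q d : nat) : 0 < m ->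
  hpp m n x y z w g s r q d = 0%R ->
  x ^ m <= n /\ [:: x; y; z; w; g; s; r; q; d] = hpp_zero m n x.
Proof.
move=> m0 /hpp_eq0 [ez es [ew eg ey h6 h7]].
rewrite /hpp_zero; set z0 := 2 ^ _ in ez *.
have lt0 : x ^ m + x < z0 := expn_add_lt m x m0.
have es' : s = z0 ^ m by rewrite es /z0 -expnM; congr (2 ^ _); nia.
have ediv : z0 ^ m = q * (z0 - x) + r by rewrite -es' mulnBr; nia.
have rlt : r < z0 - x by lia.
have er : r = x ^ m.
  rewrite -[r](modn_small rlt) -(modnMDl q) -ediv -modnXm.
  have -> : z0 = x + (z0 - x) by lia.
  by rewrite addKn modnDr modnXm modn_small //; lia.
have eq : q = z0 ^ m %/ (z0 - x).
  by rewrite ediv divnMDl ?divn_small ?addn0 //; lia.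
split; first by lia.
rewrite /= -eq es' ew eg ez -er.
by do !congr cons; lia.
Qed.

Lemma hpp_zero_exists (m n x : nat) : 0 < m -> x ^ m <= n ->
  let z0 := 2 ^ (3 * m * x) in let q0 := z0 ^ m %/ (z0 - x) in
  hpp m n x (n - x ^ m) z0 (x * q0) (z0 * q0) (z0 ^ m) (x ^ m) q0
    (z0 - x - x ^ m - 1) = 0%R.
Proof.
move=> m0 hx z0 q0; apply/hpp_eq0; rewrite -/z0.
have lt0 : x ^ m + x < z0 := expn_add_lt m x m0.
have es : z0 ^ m = 2 ^ (3 * m ^ 2 * x).
  by rewrite /z0 -expnM; congr (2 ^ _); nia.
split=> //; split=> //; try lia.
have er : z0 ^ m %% (z0 - x) = x ^ m.
  rewrite -modnXm; have {1}-> : z0 = x + (z0 - x) by lia.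
  by rewrite modnDr modnXm modn_small //; lia.
have := divn_eq (z0 ^ m) (z0 - x); rewrite er -/q0 mulnBr => e.
(* Shows that the difference [q0 * z0 - q0 * x] in [e] is not truncated. *)
have : q0 * x <= q0 * z0 by rewrite leq_mul2l; lia.
by lia.
Qed.

(** Puts the zeros inside the cube: every coordinate is at most [(n + 1) * z0 ^ m], and the exponent
    [6 * n ^ 3 * m ^ 2] of [t] dominates this. *)
Lemma hpp_zero_lt_t (m n x : nat) : 0 < m -> 0 < n -> x ^ m <= n ->
  all (ltn^~ (t_of m n)) (hpp_zero m n x).
Proof.
move=> m0 n0 hx; rewrite /hpp_zero; set z0 := 2 ^ _; set q0 := _ %/ _.
have lt0 : x ^ m + x < z0 := expn_add_lt m x m0.
have xn : x <= n.
  by apply: leq_trans hx; case: (x) => // x'; rewrite -{1}[x'.+1]expn1 leq_pexp2l.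
have zs : z0 <= z0 ^ m by rewrite -{1}[z0]expn1 leq_pexp2l //; lia.
have q_le : q0 <= z0 ^ m by apply: leq_div.
have st : (n + 1) * z0 ^ m < t_of m n.
  have mn : n + 3 * m * n * m < 6 * n ^ 3 * m ^ 2.
    have n3 : n <= n ^ 3 by rewrite -{1}[n]expn1 leq_pexp2l.
    have m2 : n * m ^ 2 <= n ^ 3 * m ^ 2 by rewrite leq_mul2r n3 orbT.
    by nia.
  have e1 : z0 ^ m <= 2 ^ (3 * m * n * m).
    by rewrite /z0 -expnM leq_pexp2l // leq_mul2r leq_mul2l xn !orbT.
  have e2 : n + 1 <= 2 ^ n by rewrite addn1 ltn_expl.
  apply: leq_ltn_trans (leq_mul e2 e1) _.
  by rewrite -expnD /t_of ltn_exp2l.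
have xq : x * q0 <= n * z0 ^ m by rewrite leq_mul.
(* Bounding the factors separately is too weak; the equation [g + r = s + w] gives
   [z0 * q0 <= z0 ^ m + x * q0]. *)
have zq : z0 * q0 <= (n + 1) * z0 ^ m.
  have [_ _ [_ _ _ h _]] := proj1 (hpp_eq0 _ _ _ _ _ _ _ _ _ _ _)
    (hpp_zero_exists m n x m0 hx).
  by rewrite -/z0 -/q0 in h; lia.
have nz : n * 1 <= n * z0 ^ m by rewrite leq_mul2l; lia.
by rewrite /= !andbT; do !(apply/andP; split); lia.
Qed.

Lemma card_hpp_zeros (m n : nat) : 0 < m -> 0 < n ->
  #|[set a : {ffun 'I_9 -> 'I_(t_of m n)} |
      let v (k : nat) : nat := a (inord k) in
      hpp m n (v 0) (v 1) (v 2) (v 3) (v 4) (v 5) (v 6) (v 7) (v 8) == 0%R]|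
  = (floor_root m n).+1.
Proof.
move=> m0 n0; have t0 : 0 < t_of m n by rewrite expn_gt0.
pose phi (x : 'I_(floor_root m n).+1) :=
  (* The default [0] of [insubd] is never reached, as all coordinates lie below [t]. *)
  [ffun i : 'I_9 => insubd (Ordinal t0) (nth 0 (hpp_zero m n x) i)].
have [root_le root_max] := floor_rootP n m0.
have le_root (x : 'I_(floor_root m n).+1) : x ^ m <= n.
  by apply: leq_trans root_le; rewrite leq_exp2r // -ltnS.
have phiE x k : k < 9 -> phi x (inord k) = nth 0 (hpp_zero m n x) k :> nat.
  move=> k9; rewrite ffunE inordK // val_insubd ifT //.
  exact: (all_nthP 0 (hpp_zero_lt_t m n x m0 n0 (le_root x))).
have phi_inj : injective phi.
  move=> x x' /(congr1 (fun a : {ffun 'I_9 -> 'I__} => a (inord 0) : nat)).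
  by rewrite !phiE // => /val_inj.
rewrite -[RHS]card_ord -(card_imset _ phi_inj); congr #|pred_of_set _|.
apply/setP => a; rewrite inE /=; apply/eqP/imsetP => [ha | [x _ ->]]; last first.
  by rewrite !phiE //; apply: (hpp_zero_exists m n x m0 (le_root x)).
have [xn ea] := hpp_zero_unique _ _ _ _ _ _ _ _ _ _ _ m0 ha.
have hx : a (inord 0) < (floor_root m n).+1 by rewrite ltnS root_max.
exists (Ordinal hx) => //; apply/ffunP => i; apply: ord_inj.
rewrite -[i]inord_val phiE //= -ea.
by case: i => [[|[|[|[|[|[|[|[|[|]]]]]]]]] hi].
Qed.

Local Open Scope ring_scope.

Theorem theorem6p1 (m n : nat) (hm : (1 <= m)%N) (hn : (1 <= n)%N) :
  let t := t_of m n in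
  let u := u_of t in
  (floor_root m n)%:R =
    ((HW (Num.truncn (M hpp m n t u)))%:R / u%:R - t%:R ^+ 9) - 1 :> rat.
Proof.
move=> t u.
have u_neq0 : u%:R != 0 :> rat by rewrite pnatr_eq0 /u /u_of addn_eq0 andbF.
rewrite /M HW_sum_delta; first last.
- by move=> a; apply: hpp_itv.
- by move=> a; apply: hpp_int.
(* The zeros are counted from [x = 0], so there is one more than the root; hence the final [- 1]. *)
rewrite card_hpp_zeros // natrM mulrAC mulfV // mul1r natrD natrX.
rewrite -(addn1 (floor_root m n)) natrD -/t.
by ring.
Qed.
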